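(* Let $A=\langle\langle a,b\rangle\rangle$ with $\dim A\geq2$, where $a$ is a weakly primitive axis satisfying the fusion rules and $b=\alpha_ba+b_0+\sum_{(\mu,\nu)\in S(a)}b_{\mu,\nu}$ is an axis. Suppose $b_0=0$. Then $A_0(a)=0$. Furthermore: (i) If $S^\dagger(a)=\emptyset$, then, for $\mu=\frac1{2\alpha_b}$, $A$ is commutative, $A=\mathbb Fa\oplus\mathbb Fb_{\mu,\mu}$, $b=\alpha_ba+b_{\mu,\mu}$ and $b_{\mu,\mu}^2=\alpha_b(1-\alpha_b)a$. (ii) If $S^\dagger(a)\neq\emptyset$, then $A$ is not commutative, $\mu+\nu=1$ for all $(\mu,\nu)\in S^\circ(a)$, $A=\mathbb Fa+\sum_{(\mu,\nu)\in S^\circ(a)}\mathbb Fb_{\mu,\nu}$, $b=a+\sum_{(\mu,\nu)\in S^\circ(a)}b_{\mu,\nu}$, and $b_{\mu,\nu}^2=0$ for each $(\mu,\nu)\in S^\circ(a)$.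
   Context: $\mathbb F$ is a field of characteristic $\ne 2$. Algebras are $\mathbb F$-algebras, not assumed associative, commutative or unital; $\langle\langle X\rangle\rangle$ is the subalgebra generated by $X$. For $y\in A$ put $L_y(z)=yz$, $R_y(z)=zy$; $A_\mu(L_y)$ and $A_\nu(R_y)$ denote eigenspaces. An axis of $A$ is an idempotent $a$ such that $A$ is the direct sum of the eigenspaces of $L_a$, $A$ is the direct sum of the eigenspaces of $R_a$, and $L_aR_a=R_aL_a$. Let $S_L(a),S_R(a)$ be the sets of eigenvalues of $L_a,R_a$; $A_{\mu,\nu}(a)=A_\mu(L_a)\cap A_\nu(R_a)$; $A_\mu(a)=A_{\mu,\mu}(a)$; $S=S(a)=(S_L(a)\times S_R(a))\setminus\{(0,0),(1,1)\}$; $S^\circ(a)=\{(\mu,\nu)\in S(a):A_{\mu,\nu}(a)\neq0\}$; $S^\dagger(a)=\{(\mu,\nu)\in S^\circ(a):\mu\neq\nu\}$. So $A=A_1(a)\oplus A_0(a)\oplus\bigoplus_{(\mu,\nu)\in S}A_{\mu,\nu}(a)$, and each $y\in A$ is written accordingly as $y=y_1+y_0+\sum_{(\mu,\nu)\in S}y_{\mu,\nu}$. The axis $a$ is weakly primitive if $A_1(a)=\mathbb F a$; then $y_1=\alpha_ya$ with $\alpha_y\in\mathbb F$. The axis $a$ satisfies the fusion rules if: (a) $A_{\mu,\nu}(a)A_{\mu',\nu'}(a)=0$ for all $(\mu,\nu)\neq(\mu',\nu')$ in $S$; (b) $A_{\mu,\nu}(a)^2\subseteq A_0(a)+A_1(a)$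 for $(\mu,\nu)\in S$; (c) $(A_0(a)+A_1(a))(A_0(a)+A_1(a))\subseteq A_0(a)+A_1(a)$; (d) $(A_1(a)+A_0(a))A_{\mu,\nu}(a)\subseteq A_{\mu,\nu}(a)$ and $A_{\mu,\nu}(a)(A_1(a)+A_0(a))\subseteq A_{\mu,\nu}(a)$ for $(\mu,\nu)\in S$. *)

(* Defs.v *)
From mathcomp Require Import all_boot all_algebra.
From mathcomp Require Import boolp classical_sets functions cardinality fsbigop.
From mathcomp Require Import sesquilinear.

Set Implicit Arguments.
Unset Strict Implicit.
Unset Printing Implicit Defensive.

Import GRing.Theory.
Local Open Scope classical_set_scope.
Local Open Scope ring_scope.

(* A (not necessarily associative, commutative, unital or finite-dimensional)
   F-algebra is a vector space V : lmodType F together with a bilinear product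
   m : {bilinear V -> V -> V}. *)

Definition line (F : fieldType) (V : lmodType F) (x : V) : set V :=
  [set c *: x | c in [set: F]].

Definition sumset (F : fieldType) (V : lmodType F) (U W : set V) : set V :=
  [set u + w | u in U & w in W].

(* The unspanned set of products: inclusion in a subspace does not see the
   difference. *)
Definition mulset (F : fieldType) (V : lmodType F)
    (m : {bilinear V -> V -> V}) (U W : set V) : set V :=
  [set m u w | u in U & w in W].

Definition dim_ge (F : fieldType) (V : lmodType F) (n : nat) : Prop :=
  exists e : 'I_n -> V, forall c : 'I_n -> F,
    \sum_(i < n) c i *: e i = 0 -> forall i, c i = 0.

(* v is a choice of vectors v i \in U i for i \in D, almost all of them zero.
   It is extended by zero outside D, so that it is determined by its members. *)
Definition finite_family (F : fieldType) (V : lmodType F) (I : choiceType)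
    (D : set I) (U : I -> set V) (v : I -> V) : Prop :=
  [/\ forall i, D i -> U i (v i),
      forall i, ~ D i -> v i = 0
    & finite_set [set i | v i != 0]].

Definition sum_family (F : fieldType) (V : lmodType F) (I : choiceType)
    (D : set I) (U : I -> set V) : set V :=
  [set x | exists v, finite_family D U v /\ x = \sum_(i \in D) v i].

Definition is_direct_sum (F : fieldType) (V : lmodType F) (I : choiceType)
    (D : set I) (U : I -> set V) : Prop :=
  forall x : V, exists! v, finite_family D U v /\ x = \sum_(i \in D) v i.

Definition subalgebra (F : fieldType) (V : lmodType F)
    (m : {bilinear V -> V -> V}) (B : set V) : Prop :=
  [/\ B 0,
      forall x y, B x -> B y -> B (x + y),
      forall (c : F) x, B x -> B (c *: x)
    & forall x y, B x -> B y -> B (m x y)].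

Definition gen_alg (F : fieldType) (V : lmodType F)
    (m : {bilinear V -> V -> V}) (X : set V) : set V :=
  smallest (subalgebra m) X.

Definition commutative_alg (F : fieldType) (V : lmodType F)
    (m : {bilinear V -> V -> V}) : Prop :=
  forall x y : V, m x y = m y x.

Definition Lmul (F : fieldType) (V : lmodType F)
    (m : {bilinear V -> V -> V}) (y : V) : V -> V := fun z => m y z.

Definition Rmul (F : fieldType) (V : lmodType F)
    (m : {bilinear V -> V -> V}) (y : V) : V -> V := fun z => m z y.

Definition eigsp (F : fieldType) (V : lmodType F) (f : V -> V) (mu : F) :
    set V :=
  [set x | f x = mu *: x].

Definition eigvals (F : fieldType) (V : lmodType F) (f : V -> V) : set F :=
  [set mu | exists2 x, x != 0 & eigsp f mu x].

(* As in the source, 0 is not excluded from being an axis. *)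
Definition axis (F : fieldType) (V : lmodType F)
    (m : {bilinear V -> V -> V}) (a : V) : Prop :=
  [/\ m a a = a,
      is_direct_sum (eigvals (Lmul m a)) (eigsp (Lmul m a)),
      is_direct_sum (eigvals (Rmul m a)) (eigsp (Rmul m a))
    & Lmul m a \o Rmul m a =1 Rmul m a \o Lmul m a].

(* A_{mu,nu}(a), with p = (mu, nu) *)
Definition eigsp2 (F : fieldType) (V : lmodType F)
    (m : {bilinear V -> V -> V}) (a : V) (p : F * F) : set V :=
  eigsp (Lmul m a) p.1 `&` eigsp (Rmul m a) p.2.

(* A_mu(a) *)
Definition eigsp1 (F : fieldType) (V : lmodType F)
    (m : {bilinear V -> V -> V}) (a : V) (mu : F) : set V :=
  eigsp2 m a (mu, mu).

(* S(a) *)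
Definition Spec (F : fieldType) (V : lmodType F)
    (m : {bilinear V -> V -> V}) (a : V) : set (F * F) :=
  (eigvals (Lmul m a) `*` eigvals (Rmul m a)) `\` [set (0, 0); (1, 1)].

(* S°(a) *)
Definition Spec_circ (F : fieldType) (V : lmodType F)
    (m : {bilinear V -> V -> V}) (a : V) : set (F * F) :=
  [set p | Spec m a p /\ eigsp2 m a p <> [set 0]].

(* S†(a) *)
Definition Spec_dagger (F : fieldType) (V : lmodType F)
    (m : {bilinear V -> V -> V}) (a : V) : set (F * F) :=
  [set p | Spec_circ m a p /\ p.1 <> p.2].

Definition weakly_primitive (F : fieldType) (V : lmodType F)
    (m : {bilinear V -> V -> V}) (a : V) : Prop :=
  eigsp1 m a 1 = line a.

Definition fusion_rules (F : fieldType) (V : lmodType F)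
    (m : {bilinear V -> V -> V}) (a : V) : Prop :=
  let E := sumset (eigsp1 m a 0) (eigsp1 m a 1) in
  [/\ forall p q, Spec m a p -> Spec m a q -> p <> q ->
        mulset m (eigsp2 m a p) (eigsp2 m a q) `<=` [set 0],
      forall p, Spec m a p -> mulset m (eigsp2 m a p) (eigsp2 m a p) `<=` E,
      mulset m E E `<=` E
    & forall p, Spec m a p ->
        mulset m E (eigsp2 m a p) `<=` eigsp2 m a p /\
        mulset m (eigsp2 m a p) E `<=` eigsp2 m a p].

(* y = alpha a + y0 + sum_(p in S(a)) yS p, where y0 is in A_0(a) and yS p is
   in A_p(a).  For an axis a, y0 and yS are determined by y, and so is alpha
   when a <> 0. *)
Definition axis_decomposition (F : fieldType) (V : lmodType F)
    (m : {bilinear V -> V -> V}) (a y : V)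
    (alpha : F) (y0 : V) (yS : F * F -> V) : Prop :=
  [/\ eigsp1 m a 0 y0,
      finite_family (Spec m a) (eigsp2 m a) yS
    & y = alpha *: a + y0 + \sum_(p \in Spec m a) yS p].

(* Main.v *)
(* Write b = alpha a + sum_p b_p with b_p in A_p(a), p = (mu, nu) in S(a).
   Since b is idempotent and b_p b_q = 0 for p <> q, comparing components gives
   alpha (mu + nu) = 1 whenever b_p <> 0, and sum_p b_p^2 = alpha (1 - alpha) a.
   The (A_0 + A_1)-component of L_b R_b b_p = R_b L_b b_p reads
   alpha (nu - mu) b_p^2 = 0, so b_p^2 vanishes unless mu = nu = 1/(2 alpha):
   at most one square is nonzero, and it is alpha (1 - alpha) a.  Hence
   F a + sum_p F b_p is closed under multiplication and equals A; since it is
   spanned by eigenvectors, A_0(a) = 0 and A_p(a) = F b_p.  Finally, if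
   b_p <> 0 for some mu <> nu, the A_p-component of L_b R_b a = R_b L_b a gives
   mu + nu = 1, i.e. alpha = 1. *)
Require Import Defs.
From mathcomp Require Import all_boot all_algebra.
From mathcomp Require Import boolp classical_sets functions cardinality fsbigop.
From mathcomp Require Import sesquilinear.
From mathcomp Require Import ring.

Import GRing.Theory.
Local Open Scope classical_set_scope.
Local Open Scope ring_scope.

(** * Independence of the common eigenspaces of [L_a] and [R_a] *)

Section CommonEigenspaces.
Context {F : fieldType} {A : lmodType F} (m : {bilinear A -> A -> A}) (a : A).

Lemma eigsp2P (p : F * F) x :
  eigsp2 m a p x <-> m a x = p.1 *: x /\ m x a = p.2 *: x.
Proof. by []. Qed.

Lemma eigsp2_0 p : eigsp2 m a p 0.
Proof. by apply/eigsp2P; rewrite linear0r linear0l !scaler0. Qed.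

Lemma eigsp2D p x y : eigsp2 m a p x -> eigsp2 m a p y -> eigsp2 m a p (x + y).
Proof.
move=> /eigsp2P[xl xr] /eigsp2P[yl yr]; apply/eigsp2P.
by rewrite linearDr linearDl xl xr yl yr !scalerDr.
Qed.

Lemma eigsp2Z p c x : eigsp2 m a p x -> eigsp2 m a p (c *: x).
Proof.
move=> /eigsp2P[xl xr]; apply/eigsp2P.
by rewrite linearZr_LR linearZl_LR /= xl xr !scalerA ![c * _]mulrC.
Qed.

Lemma eigsp2B p x y : eigsp2 m a p x -> eigsp2 m a p y -> eigsp2 m a p (x - y).
Proof. by move=> px py; rewrite -scaleN1r; apply/eigsp2D/eigsp2Z. Qed.

(** Induction on [s]: applying [L_a] minus [p.1], or [R_a] minus [p.2], to the relation eliminates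
    [v p]. The shorter relations make [v q] vanish under both [q.1 - p.1] and [q.2 - p.2], and one
    of these scalars is nonzero as [q] differs from [p]. *)
Lemma eigsp2_independent (s : seq (F * F)) (v : F * F -> A) :
  uniq s -> (forall p, p \in s -> eigsp2 m a p (v p)) ->
  \sum_(p <- s) v p = 0 -> forall p, p \in s -> v p = 0.
Proof.
elim: s v => // p s IHs v /= /andP[ps us] v_eig; rewrite big_cons => v0.
have vE : v p = - \sum_(q <- s) v q by apply/eqP; rewrite -addr_eq0 v0.
have s_eig q : q \in s -> eigsp2 m a q (v q).
  by move=> qs; apply: v_eig; rewrite inE qs orbT.
have [pl pr] := (eigsp2P _ _).1 (v_eig p (mem_head _ _)).
(* Used with [fst] for the operator [L_a] and with [snd] for [R_a]. *)
have kill (f : F * F -> F) :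
    \sum_(q <- s) f q *: v q = f p *: \sum_(q <- s) v q ->
    forall q, q \in s -> (f q - f p) *: v q = 0.
  move=> fE; apply: (IHs (fun q => (f q - f p) *: v q)) => //.
    by move=> q qs; apply/eigsp2Z/s_eig.
  under eq_bigr do rewrite scalerBl.
  by rewrite sumrB fE scaler_sumr subrr.
have sv0 q : q \in s -> v q = 0.
  move=> qs.
  have k1 : (q.1 - p.1) *: v q = 0.
    apply: (kill fst) qs; move: pl.
    rewrite vE linearNr scalerN => /oppr_inj <-; rewrite linear_sumr.
    by apply: eq_big_seq => r /s_eig/eigsp2P[].
  have k2 : (q.2 - p.2) *: v q = 0.
    apply: (kill snd) qs; move: pr.
    rewrite vE linearNl scalerN => /oppr_inj <-; rewrite linear_sumlz.
    by apply: eq_big_seq => r /s_eig/eigsp2P[].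
  apply/eqP; have : q != p by apply: contra ps => /eqP <-.
  apply: contraNT => vq0; rewrite (surjective_pairing q) (surjective_pairing p).
  move/eqP: k1; rewrite scaler_eq0 (negPf vq0) orbF subr_eq0 => /eqP ->.
  by move/eqP: k2; rewrite scaler_eq0 (negPf vq0) orbF subr_eq0 => /eqP ->.
move=> q; rewrite inE => /orP[/eqP ->|/sv0 //].
by rewrite vE big_seq big1 ?oppr0.
Qed.

(** * The subspace [E], the sum of [A_0(a)] and [A_1(a)] *)

Let E := sumset (eigsp1 m a 0) (eigsp1 m a 1).

Lemma sumset01D x y : E x -> E y -> E (x + y).
Proof.
move=> [x0 hx0 [x1 hx1 <-]] [y0 hy0 [y1 hy1 <-]].
exists (x0 + y0); first exact: eigsp2D.
by exists (x1 + y1); [exact: eigsp2D | rewrite addrACA].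
Qed.

Lemma sumset01Z c x : E x -> E (c *: x).
Proof.
move=> [x0 hx0 [x1 hx1 <-]]; exists (c *: x0); first exact: eigsp2Z.
by exists (c *: x1); [exact: eigsp2Z | rewrite scalerDr].
Qed.

Lemma sumset01_sum (s : seq (F * F)) (v : F * F -> A) :
  (forall p, p \in s -> E (v p)) -> E (\sum_(p <- s) v p).
Proof.
move=> Ev; rewrite big_seq; elim/big_rec: _ => [|p x ps Ex]; last first.
  by apply: sumset01D => //; apply: Ev.
exists 0; first exact: eigsp2_0.
by exists 0; [exact: eigsp2_0 | rewrite addr0].
Qed.

Lemma sumset01_comm x : E x -> m a x = m x a.
Proof.
move=> [x0 /eigsp2P[l0 r0] [x1 /eigsp2P[l1 r1] <-]].
by rewrite linearDr linearDl l0 r0 l1 r1.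
Qed.

(** [Spec] excludes (0,0) and (1,1), so both pairs can be put in front of [s] to carry the two parts
    of [e]. This is the tool for every comparison of components below. *)
Lemma sumset01_independent (s : seq (F * F)) (v : F * F -> A) e :
  uniq s -> {in s, forall p, Spec m a p} ->
  (forall p, p \in s -> eigsp2 m a p (v p)) -> E e ->
  e + \sum_(p <- s) v p = 0 -> e = 0 /\ forall p, p \in s -> v p = 0.
Proof.
move=> us sS sv [e0 he0 [e1 he1 <-]] ev0.
have s0 : (0, 0) \notin s by apply/negP => /sS[_]; apply; left.
have s1 : (1, 1) \notin s by apply/negP => /sS[_]; apply; right.
pose w (p : F * F) := if p == (0, 0) then e0
  else if p == (1, 1) then e1 else v p.
have ws p : p \in s -> w p = v p.
  move=> ps; rewrite /w; case: eqP => [pE|_]; first by rewrite -pE ps in s0.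
  by case: eqP => // pE; rewrite -pE ps in s1.
have n01 : (1, 1) != (0, 0) :> F * F by rewrite xpair_eqE oner_eq0.
have w0 : w (0, 0) = e0 by rewrite /w eqxx.
have w1 : w (1, 1) = e1 by rewrite /w (negPf n01) eqxx.
have wE0 : forall p, p \in [:: (0, 0), (1, 1) & s] -> w p = 0.
  apply: eigsp2_independent.
  - by rewrite /= inE negb_or eq_sym n01 s0 s1.
  - move=> p; rewrite !inE => /or3P[/eqP ->|/eqP ->|ps]; rewrite ?w0 ?w1 //.
    by rewrite ws //; apply: sv.
  - rewrite !big_cons w0 w1 addrA -[RHS]ev0; congr (_ + _).
    exact: eq_big_seq.
split; first by rewrite -w0 -w1 !wE0 ?addr0 ?inE ?eqxx ?orbT.
by move=> p ps; rewrite -ws // wE0 // !inE ps !orbT.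
Qed.

End CommonEigenspaces.

Arguments sumset01_independent {F A m a s v e}.

(** * The components [u p] of [b], with support [s], and their products *)

Section AxisWithoutZeroComponent.
Context {F : fieldType} {A : lmodType F} (m : {bilinear A -> A -> A}) (a b : A).
Context (alpha : F) (s : seq (F * F)) (u : F * F -> A).
Hypothesis aa : m a a = a.
Hypothesis fus : fusion_rules m a.
Hypothesis us : uniq s.
Hypothesis sS : {in s, forall p, Spec m a p}.
Hypothesis u_eig : forall p, p \in s -> eigsp2 m a p (u p).
Hypothesis u_neq0 : {in s, forall p, u p != 0}.
Hypothesis bE : b = alpha *: a + \sum_(p <- s) u p.
Hypothesis bb : m b b = b.
Hypothesis bLR : forall x, m b (m x b) = m (m b x) b.

Let E := sumset (eigsp1 m a 0) (eigsp1 m a 1).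

Let Ea c : E (c *: a).
Proof.
exists 0; first exact: eigsp2_0.
exists (c *: a); last by rewrite add0r.
by apply/eigsp2Z/eigsp2P; rewrite aa scale1r.
Qed.

Let E_sq p : p \in s -> E (m (u p) (u p)).
Proof.
move=> ps; have [_ + _ _] := fus; move/(_ _ (sS p ps)); apply.
by exists (u p); [exact: u_eig | exists (u p); first exact: u_eig].
Qed.

Let u_au p : p \in s -> m a (u p) = p.1 *: u p.
Proof. by move=> /u_eig/eigsp2P[]. Qed.

Let u_ua p : p \in s -> m (u p) a = p.2 *: u p.
Proof. by move=> /u_eig/eigsp2P[]. Qed.

Let u_uu p q : p \in s -> q \in s -> q != p -> m (u p) (u q) = 0.
Proof.
move=> ps qs /eqP qp; have [h _ _ _] := fus.
apply: (h p q (sS p ps) (sS q qs) (fun e => qp (esym e))).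
by exists (u p); [exact: u_eig | exists (u q); first exact: u_eig].
Qed.

Let sum_ul (f : F * F -> F) p : p \in s ->
  m (u p) (\sum_(q <- s) f q *: u q) = f p *: m (u p) (u p).
Proof.
move=> ps; rewrite linear_sumr (bigD1_seq p) //= linearZr_LR /=.
rewrite big_seq_cond big1 ?addr0 // => q /andP[qs qp].
by rewrite linearZr_LR /= u_uu // scaler0.
Qed.

Let sum_ur (f : F * F -> F) p : p \in s ->
  m (\sum_(q <- s) f q *: u q) (u p) = f p *: m (u p) (u p).
Proof.
move=> ps; rewrite linear_sumlz (bigD1_seq p) //= linearZl_LR /=.
rewrite big_seq_cond big1 ?addr0 // => q /andP[qs qp].
by rewrite linearZl_LR /= u_uu 1?eq_sym // scaler0.
Qed.

(** The general element of the span of [a] and the components of [b], which turns out to be all of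
    the algebra. *)
Let comb c (f : F * F -> F) := c *: a + \sum_(p <- s) f p *: u p.

Let bC : b = comb alpha (fun=> 1).
Proof.
by rewrite bE; congr (_ + _); apply: eq_bigr => p _; rewrite scale1r.
Qed.

(** Mixed products of components vanish by the fusion rules. The result is grouped so that the first
    bracket lies in [E] and the last sum has its terms in the eigenspaces indexed by [s]. *)
Lemma mul_comb c f d g :
  m (comb c f) (comb d g) =
  ((c * d) *: a + \sum_(p <- s) (f p * g p) *: m (u p) (u p)) +
  \sum_(p <- s) (c * g p * p.1 + d * f p * p.2) *: u p.
Proof.
have SaE : m (c *: a) (\sum_(p <- s) g p *: u p) =
    \sum_(p <- s) (c * g p * p.1) *: u p.
  rewrite linear_sumr; apply: eq_big_seq => p ps.
  by rewrite linearZl_LR linearZr_LR /= u_au // !scalerA.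
have aSE : m (\sum_(p <- s) f p *: u p) (d *: a) =
    \sum_(p <- s) (d * f p * p.2) *: u p.
  rewrite linear_sumlz; apply: eq_big_seq => p ps.
  by rewrite linearZl_LR linearZr_LR /= u_ua // !scalerA [f p * _]mulrC.
have SSE : m (\sum_(p <- s) f p *: u p) (\sum_(p <- s) g p *: u p) =
    \sum_(p <- s) (f p * g p) *: m (u p) (u p).
  rewrite linear_sumlz; apply: eq_big_seq => p ps.
  by rewrite linearZl_LR /= sum_ul // scalerA.
rewrite /comb linearDl !linearDr SaE aSE SSE linearZl_LR linearZr_LR /=.
rewrite aa scalerA.
rewrite [X in _ = _ + X](eq_bigr (fun p => _ *: _ + _ *: _)
  (fun p _ => scalerDl _ _ _)).
rewrite big_split /= -!addrA; congr (_ + _).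
by rewrite addrA addrC.
Qed.

(** Only [c *: a] is claimed to vanish, not [c], because [a] may be zero here. *)
Lemma comb_inj0 c f : comb c f = 0 -> c *: a = 0 /\ {in s, forall p, f p = 0}.
Proof.
move=> cf0; have [|ca0 fu0] := sumset01_independent us sS _ (Ea c) cf0.
  by move=> p /u_eig; apply: eigsp2Z.
split=> // p ps; apply/eqP; move/eqP: (fu0 p ps).
by rewrite scaler_eq0 (negPf (u_neq0 p ps)) orbF.
Qed.

Lemma idempotent_weights : {in s, forall p, alpha * (p.1 + p.2) = 1}
  /\ \sum_(p <- s) m (u p) (u p) = (alpha * (1 - alpha)) *: a.
Proof.
have : m b b - b = 0 by rewrite bb subrr.
rewrite {1 2}bC mul_comb {1}bE opprD addrACA -sumrB => e0.
have [||e1 e2] := sumset01_independent us sS _ _ e0.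
- move=> p ps; apply: eigsp2B; last exact: u_eig.
  exact/eigsp2Z/u_eig.
- rewrite -scaleN1r scalerA; apply: sumset01D; last exact: Ea.
  apply: sumset01D; first exact: Ea.
  by apply: sumset01_sum => p ps; apply/sumset01Z/E_sq.
split=> [p ps|].
  apply/eqP; rewrite -subr_eq0; move/eqP: (e2 p ps).
  rewrite -[X in _ - X]scale1r -scalerBl scaler_eq0 (negPf (u_neq0 p ps)) orbF.
  by rewrite !mulr1 mulrDr.
move/eqP: e1; rewrite addrAC -scalerBl addrC addr_eq0 -scaleNr => /eqP.
under eq_bigr do rewrite mulr1 scale1r.
by move=> ->; congr (_ *: _); ring.
Qed.

Let alpha_neq0 p : p \in s -> alpha != 0.
Proof.
move=> /idempotent_weights.1 h; apply/eqP => al0.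
by move/eqP: h; rewrite al0 mul0r eq_sym oner_eq0.
Qed.

Lemma asymmetric_sq0 p : p \in s -> p.1 != p.2 -> m (u p) (u p) = 0.
Proof.
move=> ps p12; set w := m (u p) (u p).
have Ew : E w by exact: E_sq.
have al0 := alpha_neq0 p ps.
have bu : m b (u p) = (alpha * p.1) *: u p + w.
  rewrite bC linearDl linearZl_LR /= u_au // scalerA sum_ur //.
  by rewrite scale1r.
have ub : m (u p) b = (alpha * p.2) *: u p + w.
  rewrite bC linearDr linearZr_LR /= u_ua // scalerA sum_ul //.
  by rewrite scale1r.
have := bLR (u p); rewrite bu ub linearDr linearDl linearZr_LR linearZl_LR /=.
rewrite bu ub !scalerDr !scalerA [alpha * p.2 * _]mulrC.
move/eqP; rewrite -!addrA (inj_eq (addrI _)) => /eqP.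
(* Expand [b] in its products with [w]. The terms with [a] agree on both sides because [w] lies in
   [E], and each product of [w] with [u q] stays in the eigenspace of [q]. The [E]-component left
   over is [alpha * (p.2 - p.1)] times [w]. *)
rewrite bE linearDr linearDl linearZl_LR linearZr_LR /=.
rewrite linear_sumlz linear_sumr (sumset01_comm _ _ _ Ew).
rewrite addrCA [in RHS]addrCA => /addrI.
move/eqP; rewrite -subr_eq0 opprD addrACA -scalerBl -sumrB => /eqP e0.
have [||+ _] := sumset01_independent us sS _ _ e0.
- move=> q qs; have [_ _ _ /(_ q (sS q qs))[hl hr]] := fus.
  apply: eigsp2B; [apply: hr | apply: hl].
    by exists (u q); [exact: u_eig | exists w].
  by exists w => //; exists (u q); first exact: u_eig.
- exact: sumset01Z.
move/eqP; rewrite scaler_eq0 -mulrBr mulf_eq0 (negPf al0) /= subr_eq0.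
by rewrite eq_sym (negPf p12) /= => /eqP.
Qed.

Hypothesis charF : (2 : F) != 0.

Lemma symmetric_weight p : p \in s -> p.1 = p.2 ->
  p = (1 / (2 * alpha), 1 / (2 * alpha)).
Proof.
move=> ps p12; have al0 := alpha_neq0 p ps; have := idempotent_weights.1 p ps.
rewrite (surjective_pairing p) -p12 /= => h.
suff -> : p.1 = 1 / (2 * alpha) by [].
by apply: (canRL (mulfK _)); [rewrite mulf_neq0 | rewrite -[RHS]h; ring].
Qed.

Lemma component_sq p : p \in s ->
  m (u p) (u p) = (if p.1 == p.2 then alpha * (1 - alpha) else 0) *: a.
Proof.
move=> ps; case: eqP => [p12|/eqP p12]; last first.
  by rewrite asymmetric_sq0 // scale0r.
(* All symmetric pairs of [s] coincide, so [p] contributes the only square that can survive in the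
   sum. *)
rewrite -idempotent_weights.2 (bigD1_seq p) //= big_seq_cond big1 ?addr0 //.
move=> q /andP[qs qp]; apply: asymmetric_sq0 => //.
apply: contra qp => /eqP q12.
by rewrite (symmetric_weight p ps p12) (symmetric_weight q qs q12).
Qed.

(** * The algebra generated by [a] and [b], and its eigenspaces *)

Hypothesis gen : gen_alg m [set a; b] = [set: A].

Lemma gen_comb x : exists c f, x = comb c f.
Proof.
have : [set: A] x by [].
rewrite -gen => /(_ [set y | exists c f, y = comb c f]); apply.
split; last first.
  move=> y [->|->]; last by exists alpha, (fun=> 1).
  exists 1, (fun=> 0); rewrite /comb scale1r big1 ?addr0 // => p _.
  by rewrite scale0r.
split=> [|y z [c [f ->]] [d [g ->]]|k y [c [f ->]]|y z [c [f ->]] [d [g ->]]].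
- exists 0, (fun=> 0); rewrite /comb scale0r big1 ?addr0 // => p _.
  by rewrite scale0r.
- exists (c + d), (fun p => f p + g p); rewrite /comb addrACA -big_split /=.
  by rewrite scalerDl; congr (_ + _); apply: eq_bigr => p _; rewrite scalerDl.
- exists (k * c), (fun p => k * f p).
  rewrite /comb scalerDr scalerA scaler_sumr.
  by congr (_ + _); apply: eq_bigr => p _; rewrite scalerA.
- rewrite mul_comb.
  (* Each square of a component is [k p *: a], so the squares are absorbed into the coefficient of
     [a]; this closes the span under products. *)
  pose k (p : F * F) : F := if p.1 == p.2 then alpha * (1 - alpha) else 0.
  exists (c * d + \sum_(p <- s) f p * g p * k p).
  exists (fun p => c * g p * p.1 + d * f p * p.2).
  rewrite /comb scalerDl scaler_suml; congr (_ + _ + _).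
  by apply: eq_big_seq => p ps; rewrite component_sq // scalerA.
Qed.

Let comb_left c f : m a (comb c f) = comb c (fun p => p.1 * f p).
Proof.
rewrite /comb linearDr linearZr_LR /= aa linear_sumr; congr (_ + _).
by apply: eq_big_seq => p ps; rewrite linearZr_LR /= u_au // scalerA mulrC.
Qed.

Let comb_right c f : m (comb c f) a = comb c (fun p => p.2 * f p).
Proof.
rewrite /comb linearDl linearZl_LR /= aa linear_sumlz; congr (_ + _).
by apply: eq_big_seq => p ps; rewrite linearZl_LR /= u_ua // scalerA mulrC.
Qed.

(** If [comb c f] lies in this eigenspace, comparing components of its products with [a] shows that
    a nonzero [f q] forces [q = p], and a nonzero [c *: a] forces [p = (1, 1)]. The pair (0,0)
    yields the vanishing of [A_0(a)]. *)
Lemma eigsp2_trivial p : p \notin s -> p != (1, 1) -> eigsp2 m a p = [set 0].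
Proof.
move=> ps p1; apply/seteqP; split=> [x|_ ->]; last exact: eigsp2_0.
have [c [f ->]] := gen_comb x; move=> /eigsp2P.
have combZB k d g : comb d g - k *: comb c f =
    comb (d - k * c) (fun q => g q - k * f q).
  rewrite /comb scalerDr opprD addrACA scalerA -scalerBl; congr (_ + _).
  rewrite scaler_sumr -sumrB; apply: eq_bigr => q _.
  by rewrite scalerA scalerBl.
rewrite comb_left comb_right => -[/eqP + /eqP].
rewrite -![_ == _ *: _]subr_eq0 !combZB.
move=> /eqP/comb_inj0[c1 f1] /eqP/comb_inj0[c2 f2].
rewrite /= /comb big_seq big1 ?addr0 => [|q qs].
  apply/eqP; move: p1; apply: contraNT => ca0.
  have c_neq0 : c != 0 by apply: contra ca0 => /eqP->; rewrite scale0r.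
  have a_neq0 : a != 0 by apply: contra ca0 => /eqP->; rewrite scaler0.
  have aux k : (c - k * c) *: a = 0 -> k = 1.
    move/eqP; rewrite scaler_eq0 (negPf a_neq0) orbF -{1}[c]mul1r -mulrBl.
    by rewrite mulf_eq0 (negPf c_neq0) orbF subr_eq0 => /eqP.
  by rewrite (surjective_pairing p) (aux _ c1) (aux _ c2).
suff -> : f q = 0 by rewrite scale0r.
have qp : q != p by apply: contra ps => /eqP <-.
apply/eqP; move: qp; apply: contraNT => fq0.
have aux k l : k * f q - l * f q = 0 -> k = l.
  move/eqP; rewrite -mulrBl mulf_eq0 (negPf fq0) orbF subr_eq0 => /eqP //.
rewrite (surjective_pairing p) (surjective_pairing q).
by rewrite (aux _ _ (f1 q qs)) (aux _ _ (f2 q qs)).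
Qed.

(** Turns statements about S°(a) and S†(a) into statements about the support of [b]. *)
Lemma Spec_circE : Spec_circ m a = [set` s].
Proof.
apply/seteqP; split=> p /=.
  move=> [[_ pS] pN]; apply/negPn/negP => ps; apply/pN/eigsp2_trivial => //.
  by apply/eqP => p1; apply: pS; right.
move=> ps; split; first exact: sS.
move=> p0; have := u_eig p ps; rewrite p0 => /eqP.
by rewrite (negPf (u_neq0 p ps)).
Qed.

Lemma asymmetric_weight1 p : p \in s -> p.1 != p.2 -> p.1 + p.2 = 1.
Proof.
move=> ps p12; have al0 := alpha_neq0 p ps.
have := bLR a; rewrite {2 3}bC comb_left comb_right bC !mul_comb => /eqP.
rewrite -subr_eq0 opprD addrACA -sumrB => /eqP e0.
have [||_ /(_ p ps)] := sumset01_independent us sS _ _ e0.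
- by move=> q qs; apply: eigsp2B; apply/eigsp2Z/u_eig.
- rewrite -scaleN1r; apply: sumset01D; last apply: sumset01Z.
  + apply: sumset01D; first exact: Ea.
    by apply: sumset01_sum => q qs; apply/sumset01Z/E_sq.
  + apply: sumset01D; first exact: Ea.
    by apply: sumset01_sum => q qs; apply/sumset01Z/E_sq.
rewrite -scalerBl => /eqP; rewrite scaler_eq0 (negPf (u_neq0 p ps)) orbF.
(* The difference of the coefficients of [u p] in [b(ab)] and [(ba)b]; its factors [alpha] and
   [p.1 - p.2] are nonzero. *)
have -> : alpha * (p.1 * 1) * p.1 + alpha * 1 * p.2 -
    (alpha * 1 * p.1 + alpha * (p.2 * 1) * p.2) =
    alpha * (p.1 - p.2) * (p.1 + p.2 - 1) by ring.
rewrite !mulf_eq0 (negPf al0) !subr_eq0 (negPf p12) /=.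
by move=> /eqP.
Qed.

Lemma nonempty_support : dim_ge A 2 -> s != [::].
Proof.
move=> [e he]; apply/eqP => s0.
have eC i : exists c, e i = c *: a.
  have [c [f ->]] := gen_comb (e i); exists c.
  by rewrite /comb s0 big_nil addr0.
have [c0 e0] := eC ord0; have [c1 e1] := eC ord_max.
have c0_0 : c0 = 0.
  (* The relation [c1 e_0 - c0 e_1 = 0] between two multiples of [a] forces [c0 = 0]; then
     [e_0 = 0], against independence. *)
  have := he (fun i => if i == ord0 then c1 else - c0).
  rewrite !big_ord_recl big_ord0 addr0 /=.
  rewrite (_ : lift ord0 ord0 = ord_max); last exact: val_inj.
  rewrite e0 e1 !scalerA mulrC mulNr scaleNr subrr => /(_ erefl ord_max) /eqP.
  by rewrite /= oppr_eq0 => /eqP.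
have := he (fun i => if i == ord0 then 1 else 0).
rewrite !big_ord_recl big_ord0 addr0 /= scale0r addr0 e0 c0_0 scale0r scaler0.
by move=> /(_ erefl ord0)/eqP; rewrite /= oner_eq0.
Qed.

(** By [symmetric_weight] all entries of [s] are the same pair, and [s] has no repetitions. *)
Lemma symmetric_case : s != [::] -> {in s, forall p, p.1 = p.2} ->
  let mu := 1 / (2 * alpha) in
  s = [:: (mu, mu)].
Proof.
move=> + sym; move: us.
case: s sym symmetric_weight => [//|p r] sym wt /= /andP[pr ur] _.
rewrite (wt p (mem_head _ _) (sym p (mem_head _ _))).
case: r pr ur sym wt => [//|q r] pr _ sym wt.
have qr : q \in [:: p, q & r] by rewrite !inE eqxx orbT.
move: pr; rewrite (wt q qr (sym q qr)).
by rewrite (wt p (mem_head _ _) (sym p (mem_head _ _))) mem_head.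
Qed.

Lemma symmetric_commutative : {in s, forall p, p.1 = p.2} -> commutative_alg m.
Proof.
move=> sym x y; have [c [f ->]] := gen_comb x; have [d [g ->]] := gen_comb y.
rewrite !mul_comb; congr (_ + _ + _); first by rewrite mulrC.
- by apply: eq_bigr => p _; rewrite mulrC.
- by apply: eq_big_seq => p ps; rewrite (sym p ps) addrC.
Qed.

End AxisWithoutZeroComponent.

(** * Passage to a finite support, and the two cases *)

Theorem theorem3p13 (F : fieldType) (charF : 2%N \notin [pchar F])
    (A : lmodType F) (m : {bilinear A -> A -> A}) (a b : A)
    (alpha : F) (b0 : A) (bS : F * F -> A) :
  gen_alg m [set a; b] = [set: A] ->
  dim_ge A 2 ->
  axis m a -> weakly_primitive m a -> fusion_rules m a ->
  axis m b ->
  axis_decomposition m a b alpha b0 bS ->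
  b0 = 0 ->
  [/\ eigsp1 m a 0 = [set 0],
      Spec_dagger m a = set0 ->
        alpha != 0 /\
        let mu := 1 / (2 * alpha) in
        [/\ commutative_alg m,
            sumset (line a) (line (bS (mu, mu))) = [set: A],
            line a `&` line (bS (mu, mu)) = [set 0],
            b = alpha *: a + bS (mu, mu)
          & m (bS (mu, mu)) (bS (mu, mu)) = (alpha * (1 - alpha)) *: a]
    & Spec_dagger m a <> set0 ->
        [/\ ~ commutative_alg m,
            forall p, Spec_circ m a p -> p.1 + p.2 = 1,
            sumset (line a)
              (sum_family (Spec_circ m a) (fun p => line (bS p))) = [set: A],
            b = a + \sum_(p \in Spec_circ m a) bS p
          & forall p, Spec_circ m a p -> m (bS p) (bS p) = 0]].
Proof.
move=> gen dim2 [aa _ _ _] _ fus [bb _ _ bLR] [_ [bS_eig bS_out bS_fin] bE] b00.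
have two_neq0 : (2 : F) != 0 by move: charF; rewrite inE.
have /finite_seqP[t tE] := bS_fin.
(* A repetition-free list of the support of [bS]; it lies in [Spec m a] because [bS] is extended by
   zero. *)
pose s := undup t.
have us : uniq s := undup_uniq t.
have sP p : (p \in s) = (bS p != 0).
  rewrite mem_undup; have /= e : (bS p != 0) = (p \in t) :> Prop.
    exact: (congr1 (@^~ p) tE).
  by apply/idP/idP; rewrite e.
have sS : {in s, forall p, Spec m a p}.
  by move=> p; rewrite sP => /eqP bp; apply: contrapT => /bS_out.
have s_eig p : p \in s -> eigsp2 m a p (bS p) by move=> /sS/bS_eig.
have s_neq0 : {in s, forall p, bS p != 0} by move=> p; rewrite sP.
have bsE : b = alpha *: a + \sum_(p <- s) bS p.
  rewrite bE b00 addr0 [in RHS]fsbig_seq //.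
  rewrite (fsbig_widen [set` s] (Spec m a)) //.
  by move=> p /= [_ /negP]; rewrite sP negbK => /eqP.
have CE := Spec_circE m a b alpha s bS aa fus us sS s_eig s_neq0 bsE bb bLR
  two_neq0 gen.
have gC := gen_comb m a b alpha s bS aa fus us sS s_eig s_neq0 bsE bb bLR
  two_neq0 gen.
have [wt sq_sum] := idempotent_weights m a b alpha s bS aa fus us sS s_eig
  s_neq0 bsE bb.
have sN0 := nonempty_support m a b alpha s bS aa fus us sS s_eig s_neq0 bsE bb
  bLR two_neq0 gen dim2.
have al0 : alpha != 0.
  have [p ps] : exists p, p \in s.
    by case: (s) sN0 => // p r _; exists p; exact: mem_head.
  by apply/eqP => al0; move/eqP: (wt p ps); rewrite al0 mul0r eq_sym oner_eq0.
split.
- apply: (eigsp2_trivial m a b alpha s bS) => //.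
    by apply/negP => /sS[_]; apply; left.
  by rewrite xpair_eqE eq_sym oner_eq0.
- move=> dag0; split=> // mu.
  have sym : {in s, forall p, p.1 = p.2}.
    move=> p ps; apply: contrapT => p12.
    by have : Spec_dagger m a p; [split=> //; rewrite CE | rewrite dag0].
  have sE : s = [:: (mu, mu)] by apply: (symmetric_case m a b alpha s bS).
  have b_eq : b = alpha *: a + bS (mu, mu) by rewrite bsE sE big_seq1.
  split=> //.
  + exact: (symmetric_commutative m a b alpha s bS).
  + apply/seteqP; split=> // x _; have [c [f ->]] := gC x; rewrite sE big_seq1.
    exists (c *: a); first by exists c.
    by exists (f (mu, mu) *: bS (mu, mu)) => //; exists (f (mu, mu)).
  + apply/seteqP; split=> [x [[c _ <-] [d _ dE]]|_ ->]; last first.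
      by split; exists 0; rewrite // scale0r.
    (* A common element [c *: a = d *: bS (mu, mu)] of the two lines gives a vanishing combination
       with coefficients [c] and [- d]. *)
    have := comb_inj0 m a s bS aa us sS s_eig s_neq0 c (fun=> - d).
    rewrite sE big_seq1 scaleNr dE subrr => /(_ erefl)[] //.
  + by rewrite -sq_sum sE big_seq1.
- move=> /eqP/set0P[p [pS /eqP p12]].
  have ps : p \in s by move: pS; rewrite CE.
  have p1 : p.1 + p.2 = 1 by apply: (asymmetric_weight1 m a b alpha s bS).
  (* One asymmetric pair fixes [alpha]; the weight equation then yields coordinate sum 1 for every
     pair of the support, symmetric ones included. *)
  have al1 : alpha = 1 by rewrite -(wt p ps) p1 mulr1.
  split.
  (* [a] and [bS p] do not commute: the two products are distinct multiples of a nonzero vector. *)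
  + move=> /(_ a (bS p)); have [-> ->] := (eigsp2P _ _ _ _).1 (s_eig p ps).
    move=> /eqP; rewrite -subr_eq0 -scalerBl scaler_eq0.
    by rewrite (negPf (s_neq0 p ps)) orbF subr_eq0 (negPf p12).
  + by move=> q; rewrite CE => /wt; rewrite al1 mul1r.
  + apply/seteqP; split=> // x _; have [c [f ->]] := gC x.
    exists (c *: a); first by exists c.
    exists (\sum_(q <- s) f q *: bS q) => //.
    exists (fun q => f q *: bS q); split.
      split=> [q _|q|].
      * by exists (f q).
      * by rewrite CE /= => /negP; rewrite sP negbK => /eqP ->; rewrite scaler0.
      * apply: sub_finite_set bS_fin => q /=; apply: contra => /eqP ->.
        by rewrite scaler0.
    by rewrite CE fsbig_seq.
  + by rewrite {1}bsE al1 scale1r CE fsbig_seq.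
  + move=> q; rewrite CE => qs.
    (* With [alpha = 1] the coefficient [alpha * (1 - alpha)] vanishes too, so a symmetric component
       also squares to zero. *)
    rewrite (component_sq m a b alpha s bS) // al1 subrr mulr0.
    by rewrite if_same scale0r.
Qed.
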